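(* Let $\Gamma\subset\{x\in\mathbb R^d:\|x\|_2\le\frac1{2B}\}$ and let $(\gamma_n)_{n\ge1}\subset\Gamma$ be a betting strategy, with associated processes $L_n^{\rm C}(\gamma)$ and $W_n^{\rm C}$ as defined in the context. Assume that the regret $\mathcal R_n:=\max_{\gamma\in\Gamma}\log L_n^{\rm C}(\gamma)-\log W_n^{\rm C}$ satisfies $\rho:=\sum_{n\ge1}\mathbb P[\mathcal R_n>r_n]<+\infty$ for some nonnegative sequence $(r_n)_{n\ge1}$. Let $(m_n)_{n\ge1}$, $(v_n)_{n\ge1}$ be nonnegative sequences and suppose that $$\varrho_{2,\infty}:=\sum_{n\ge1}\mathbb P\big(\|\mu_n\|_\infty<m_n\ \text{or}\ \nu_{n,\infty}>v_n\big)<+\infty .$$ Let $\mathcal E=\{\epsilon>0:\ \epsilon \mathrm e_i\in\Gamma\ \text{for all } i=1,\dots,2d\}$. Then for any deterministic sequence $(\epsilon_n)_{n\ge1}\subset\mathcal E$, with $$u_n:=n\epsilon_nm_n-4n\epsilon_n^2v_n-r_n-2\log(2dn^2),$$ one has $$\sum_{n\ge1}\mathbb P[\log W_n^{\rm C}<u_n]\le\rho+\varrho_{2,\infty}+\frac{\pi^2}{6}<+\infty.\qquad(\ast)$$ In particular, one can take $(u_n)_{n\ge1}$ in $(\ast)$ as follows. 1. If $\{\epsilon \mathrm e_1,\dots,\epsilon \mathrm e_{2d}\}\subset\Gamma$ for some fixed $\epsilon\in(0,\frac1{2B}]$, then $u_n:=\epsilon nm_n-4\epsilon^2nv_n-2\log(2dn^2)-r_n$.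 2. If $\{\epsilon \mathrm e_i:\epsilon\in[0,\frac1{2B}],\,i=1,\dots,2d\}\subset\Gamma$, then $u_n:=\frac{nm_n}{4}\Big(\frac1B\wedge\frac{m_n}{4v_n}\Big)-2\log(2dn^2)-r_n$. Hence $\liminf_{n\to+\infty}\frac{\log W_n^{\rm C}}{u_n}\ge1$ $\mathbb P$-a.s., and for any $\alpha\in(0,1)$, $$\mathbb E[\tau_\alpha^{\rm C}]\le\rho+\varrho_{2,\infty}+\frac{\pi^2}{6}+\aleph\big((u_n)_{n\ge1},\log(1/\alpha)\big).$$
   Context: Let $(\Omega,\mathcal F,\mathbb P)$ be a probability space with filtration $(\mathcal F_t)_{t\in\mathbb N}$, and write $\mathbb E_{t-1}[\cdot]=\mathbb E[\cdot\mid\mathcal F_{t-1}]$. $(X_t)_{t\in\mathbb N}$ is an adapted process valued in a bounded set $\mathsf X\subset\mathbb R^d$, $d\ge1$, with $B:=\sup_{x\in\mathsf X}\|x\|_2$. Put $\mu_n:=\frac1n\sum_{t=1}^n\mathbb E_{t-1}[X_t]$ and $\nu_{n,\infty}:=\frac1n\sum_{t=1}^n\mathbb E_{t-1}[\|X_t\|_\infty^2]$. The vectors $\mathrm e_1,\dots,\mathrm e_{2d}$ are such that $(\mathrm e_1,\dots,\mathrm e_d)$ is the canonical basis of $\mathbb R^d$ and $\mathrm e_{d+i}=-\mathrm e_i$ for $i=1,\dots,d$. A betting strategy is a predictable sequence ($\gamma_n$ is $\mathcal F_{n-1}$-measurable). For $\gamma\in\Gamma$, $$L_n^{\rm C}(\gamma)=\prod_{t=1}^n(1+\gamma^\top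 X_t),\qquad W_n^{\rm C}=\prod_{t=1}^n(1+\gamma_t^\top X_t).$$ The sequences $(r_n)$, $(m_n)$, $(v_n)$ are deterministic. Also $\tau_\alpha^{\rm C}:=\inf\{n\in\mathbb N:W_n^{\rm C}\ge1/\alpha\}$, $\aleph((u_n)_{n\ge1},x):=\inf\{n\ge1:\inf_{k\ge n}u_k\ge x\}$ (with $\inf\emptyset=+\infty$), and $a\wedge b=\min(a,b)$.
   Formalization: The almost sure claim liminf log W_n/u_n ≥ 1 is proved under the added condition that u_n > 0 for all large n; without it the claim fails, e.g. X_t = 0, γ_t = 0, r_n = m_n = 0, v_n = 1 give W_n = 1, u_n < 0 and liminf 0. *)

(* Defs.v *)
From HB Require Import structures.
From mathcomp Require Import all_boot all_order all_algebra.
From mathcomp Require Import all_classical all_reals all_analysis.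

Set Implicit Arguments.
Unset Strict Implicit.
Unset Printing Implicit Defensive.

Import Order.TTheory GRing.Theory Num.Theory.
Import numFieldNormedType.Exports.

Local Open Scope classical_set_scope.
Local Open Scope ring_scope.

(* Vectors of R^d are row vectors. The norm `|x| that MathComp-Analysis puts
   on 'rV[R]_d is the max norm, i.e. the l^oo norm of x. *)

Definition dotv (R : realType) (d : nat) (x y : 'rV[R]_d) : R :=
  \sum_(i < d) x ord0 i * y ord0 i.

Definition norm2 (R : realType) (d : nat) (x : 'rV[R]_d) : R :=
  Num.sqrt (dotv x x).

(* The 2d signed basis vectors: the indices 0, ..., d-1 give the canonical
   basis and d, ..., 2d-1 give its opposites. *)
Definition signed_basis (R : realType) (d : nat) (i : 'I_(d + d)) : 'rV[R]_d :=
  match fintype.split i with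
  | inl j => delta_mx ord0 j
  | inr j => - delta_mx ord0 j
  end.

Section FilteredSpace.
Context (dsp : measure_display) (T : measurableType dsp) (R : realType).
Implicit Types (G : set (set T)) (F : nat -> set (set T)).

Definition filtration F : Prop :=
  [/\ forall t, sigma_algebra [set: T] (F t),
      forall t, F t `<=` measurable &
      forall s t, (s <= t)%N -> F s `<=` F t].

Definition measurable_wrt G (Y : T -> R) : Prop :=
  forall A : set R, measurable A -> G (Y @^-1` A).

Definition measurablev_wrt (d : nat) G (Y : T -> 'rV[R]_d) : Prop :=
  forall i, measurable_wrt G (fun w => Y w ord0 i).

Definition adapted (d : nat) F (X : nat -> T -> 'rV[R]_d) : Prop :=
  forall t, measurablev_wrt (F t) (X t).

(* Indexed by n >= 1; the value at 0 plays no role. *)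
Definition predictable (d : nat) F (g : nat -> T -> 'rV[R]_d) : Prop :=
  forall n, measurablev_wrt (F n) (g n.+1).

(* Z is a version of E[Y | G]. *)
Definition is_cond_exp (P : probability T R) G (Y Z : T -> R) : Prop :=
  [/\ measurable_wrt G Z,
      P.-integrable [set: T] (fun w => (Z w)%:E) &
      forall A, G A ->
        (\int[P]_(w in A) (Z w)%:E = \int[P]_(w in A) (Y w)%:E)%E].

Definition is_cond_expv (d : nat) (P : probability T R) G
    (Y Z : T -> 'rV[R]_d) : Prop :=
  forall i, is_cond_exp P G (fun w => Y w ord0 i) (fun w => Z w ord0 i).

End FilteredSpace.

Section Wealth.
Context (T : Type) (R : realType) (d : nat).
Implicit Types (X g : nat -> T -> 'rV[R]_d).

Definition const_wealth X (gamma : 'rV[R]_d) (n : nat) (w : T) : R :=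
  \prod_(1 <= t < n.+1) (1 + dotv gamma (X t w)).

Definition wealth X g (n : nat) (w : T) : R :=
  \prod_(1 <= t < n.+1) (1 + dotv (g t w) (X t w)).

(* The supremum equals the maximum over Gamma whenever the latter is attained;
   attainment is not required. *)
Definition regret X g (Gamma : set 'rV[R]_d) (n : nat) (w : T) : R :=
  sup [set ln (const_wealth X gamma n w) | gamma in Gamma] - ln (wealth X g n w).

Definition meanv (Y : nat -> T -> 'rV[R]_d) (n : nat) (w : T) : 'rV[R]_d :=
  n%:R^-1 *: \sum_(1 <= t < n.+1) Y t w.

Definition mean (Y : nat -> T -> R) (n : nat) (w : T) : R :=
  n%:R^-1 * \sum_(1 <= t < n.+1) Y t w.

(* The first n with W n w >= 1 / alpha, and +oo if there is none. *)
Definition hitting_time (W : nat -> T -> R) (alpha : R) (w : T) : \bar R :=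
  ereal_inf [set (n%:R)%:E | n in [set n : nat | alpha^-1 <= W n w]].

End Wealth.

Definition aleph (R : realType) (u : nat -> R) (x : R) : \bar R :=
  ereal_inf [set (n%:R)%:E | n in [set n : nat | (1 <= n)%N /\
    (x%:E <= ereal_inf [set (u k)%:E | k in [set k : nat | (n <= k)%N]])%E]].

(* min (1 / B) (m / (4 v)), where m / (4 v) is +oo if v = 0 (in MathComp
   division by 0 would give 0 instead). *)
Definition min_rate (R : realType) (B m v : R) : R :=
  if v == 0 then B^-1 else Num.min B^-1 (m / (4 * v)).

Definition in_E (R : realType) (d : nat) (Gamma : set 'rV[R]_d) (e : R) : Prop :=
  0 < e /\ forall i : 'I_(d + d), Gamma (e *: signed_basis R i).

(* The conclusions drawn from a growth sequence u with total error c. The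
   quotient ln (W n w) / u n bounds the wealth from below only where u n > 0,
   whence the proviso on the almost sure statement: if W is constantly 1 and
   every u n is negative, the quotient is constantly 0. *)
Definition growth_conclusions (dsp : measure_display) (T : measurableType dsp)
    (R : realType) (P : probability T R) (W : nat -> T -> R)
    (u : nat -> R) (c : \bar R) : Prop :=
  [/\ (\sum_(1 <= n <oo) P [set w | (ln (W n w) < u n)%R] <= c)%E,
      (c < +oo)%E,
      (\forall n \near \oo, 0 < u n) ->
        {ae P, forall w,
          (1%:E <= limn_einf (fun n => (ln (W n w) / u n)%:E))%E} &
      forall alpha : R, 0 < alpha < 1 ->
        (\int[P]_w hitting_time W alpha w <= c + aleph u (ln (alpha^-1)))%E].

(* Main.v *)
Require Import Defs.
From mathcomp Require Import all_boot all_order all_algebra.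
From mathcomp Require Import all_classical all_reals all_analysis.
From mathcomp Require Import measurable_realfun.
From mathcomp Require Import zify ring lra.

(** The regret bounds the log-wealth from below by the best constant bet up to
    r n, so it is enough to find one good constant bet.  Among the bets
    eps *: signed_basis R i, the one whose direction picks out a coordinate of
    largest modulus of the conditional mean, with its sign, has expected gain
    eps * `|mean| per round.

    For a fixed bet gamma put x_t = gamma . X_t, which lies in [-1/2, 1/2]
    because the norm of gamma is at most 1 / (2 B).  There
    (1 + x)^(-1/2) <= 1 - x / 2 + 2 x^2 (ln1D_quadratic), and x_t^2 is at most
    eps^2 `|X_t|^2.  With Y_t = 1 - x_t / 2 + 2 eps^2 `|X_t|^2 and Z_t its
    conditional expectation, the product of the Y_t exp (1 - Z_t) is a
    nonnegative supermartingale started at 1, since Z exp (1 - Z) <= 1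
    (exp_supermartingale_step).  Markov's inequality at the level 2 d n^2 then
    gives, outside an event of probability 1 / (2 d n^2),
      ln L_n >= sum of (E x_t - 4 eps^2 E `|X_t|^2) - 2 ln (2 d n^2)
    (sum_ln1D_tail).  A union bound over the 2 d signed directions costs 1 / n^2
    (wealth_tail), and these terms add up to at most pi^2 / 6
    (sum_inv_squares_le).  The union bound uses the probability of
    {r n < regret}, an event because a separability argument reduces the
    supremum over Gamma to a countable one (measurable_regret_gt).

    The remaining conclusions depend on the summable tail alone
    (growth_conclusions_of_tail): the almost sure one is the Borel-Cantelli
    lemma, and the hitting time exceeds the deterministic time after which
    u n >= ln (1 / alpha) by at most the number of later n with ln W_n < u n.

    The three growth sequences are instances of one estimate (wealth_growth), in
    which the size of the bet may vanish.  The third one takes half of min_rate,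
    which maximises eps m - 4 eps^2 v over 0 <= eps <= 1 / (2 B). *)

Set Implicit Arguments.
Unset Strict Implicit.
Unset Printing Implicit Defensive.

Import Order.TTheory GRing.Theory Num.Theory.
Import numFieldNormedType.Exports.

Local Open Scope classical_set_scope.
Local Open Scope ring_scope.

(** * The sum of the inverse squares *)

Section Basel.
Variable R : realType.
Implicit Types (x : R) (n k : nat).

Lemma sin_le_id x : 0 <= x -> sin x <= x.
Proof.
move=> x0.
have csin : {within `[0, x], continuous (@sin R)}.
  by apply: continuous_subspaceT => y; exact: continuous_sin.
have [c _] := MVT_segment x0 (fun y _ => is_derive_sin y) csin.
by rewrite sin0 !subr0 => ->; rewrite ler_piMl// cos_le1.
Qed.

(** The angles of level n.+1 pair up as t and pi / 2 - t, and doubling one angle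
    of each pair gives the angles of level n. *)
Definition odd_angle n k : R := k.*2.+1%:R * pi / 2 ^+ n.+2.

Lemma odd_angle_bounds n k : (k < 2 ^ n)%N -> 0 < odd_angle n k < pi / 2.
Proof.
move=> kn; rewrite /odd_angle; apply/andP; split.
  by rewrite divr_gt0// ?exprn_gt0// mulr_gt0// pi_gt0.
have -> : pi / 2 = 2 ^+ n.+1 * pi / 2 ^+ n.+2 :> R.
  by rewrite (exprS _ n.+1); field; rewrite ?expf_eq0 ?pnatr_eq0 ?andbF.
rewrite ltr_pM2r ?invr_gt0 ?exprn_gt0// ltr_pM2r ?pi_gt0//.
by rewrite -natrX ltr_nat expnS mul2n ltn_Sdouble.
Qed.

(** As 1 / sin^2 t + 1 / cos^2 t = 4 / sin^2 (2 t), passing to the next level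
    multiplies the sum by 4. *)
Lemma sum_inv_sin2 n :
  \sum_(0 <= k < 2 ^ n) (sin (odd_angle n k) ^+ 2)^-1 = 2 * 4 ^+ n :> R.
Proof.
elim: n => [|n IH].
  rewrite expn0 big_nat1 /odd_angle expr0 mulr1.
  have := sin2cos2 (pi / 4 : R); have := cos_mulr2n (pi / 4 : R).
  rewrite (_ : pi / 4 *+ 2 = pi / 2 :> R); last by rewrite -mulr_natr; field.
  rewrite cos_pihalf (_ : 0.*2.+1%:R * pi / 2 ^+ 2 = pi / 4 :> R); last by rewrite double0; field.
  move=> h ->; have -> : cos (pi / 4 : R) ^+ 2 = 1 / 2 by lra.
  by field.
have e2 : (2 ^ n.+1 = 2 ^ n + 2 ^ n)%N by rewrite expnS mul2n addnn.
rewrite (@big_cat_nat _ _ _ (2 ^ n)%N)//=; last by rewrite e2 leq_addr.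
rewrite e2 -[X in \sum_(X <= k < _ + _) _]add0n big_addn addnK.
(* Read backwards, the second half consists of the complementary angles. *)
rewrite [X in _ + X]big_nat_rev -big_split/= add0n.
rewrite exprS mulrCA -IH big_distrr/=.
apply: eq_big_nat => k /andP[_ kn].
have /andP[a0 a1] := odd_angle_bounds kn.
set a := odd_angle n k in a0 a1 *.
have -> : odd_angle n.+1 k = a / 2.
  by rewrite /a /odd_angle (exprS _ n.+2); field; rewrite ?expf_eq0 ?pnatr_eq0 ?andbF.
have -> : odd_angle n.+1 (2 ^ n - k.+1 + 2 ^ n) = pi / 2 - a / 2.
  have : ((2 ^ n - k.+1 + 2 ^ n).*2.+1 + k.*2.+1 = 4 * 2 ^ n)%N by lia.
  move=> /(congr1 (fun i => i%:R : R)); rewrite natrD natrM natrX => e4.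
  rewrite /a /odd_angle; set u := (X in X * pi / _ = _).
  have -> : u = 4 * 2 ^+ n - k.*2.+1%:R by rewrite -e4 addrK.
  by rewrite !exprS; field.
rewrite sinB sin_pihalf cos_pihalf mul1r mul0r subr0.
have s0 : 0 < sin (a / 2).
  by apply: sin_gt0_pihalf; have := pi_gt0 R => p0; lra.
have c0 : 0 < cos (a / 2).
  by apply: cos_gt0_pihalf; have := pi_gt0 R => p0; lra.
have -> : sin a = 2 * (sin (a / 2) * cos (a / 2)).
  have {1}-> : a = a / 2 *+ 2 by rewrite -mulr_natr; field.
  by rewrite sin_mulr2n -mulr_natl; ring.
have -> : cos (a / 2) ^+ 2 = 1 - sin (a / 2) ^+ 2 by exact: cos2sin2.
have sc := cos2Dsin2 (a / 2).
rewrite !exprMn.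
have -> : (sin (a / 2) ^+ 2)^-1 + (1 - sin (a / 2) ^+ 2)^-1 =
          (cos (a / 2) ^+ 2 + sin (a / 2) ^+ 2) / (sin (a / 2) ^+ 2 * cos (a / 2) ^+ 2).
  by rewrite -cos2sin2; field; rewrite !gt_eqF.
by rewrite sc; field; rewrite !gt_eqF.
Qed.

(** Each term of sum_inv_sin2 is at least 1 / t^2, because sin t <= t. *)
Lemma sum_inv_odd_squares_le n :
  \sum_(0 <= k < n) (k.*2.+1%:R ^+ 2)^-1 <= pi ^+ 2 / 8 :> R.
Proof.
have le2 : (n <= 2 ^ n)%N by rewrite ltnW// ltn_expl.
apply: (@le_trans _ _ (\sum_(0 <= k < 2 ^ n) (k.*2.+1%:R ^+ 2)^-1)).
  rewrite [leRHS](@big_cat_nat _ _ _ n)//= lerDl sumr_ge0//.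
rewrite -(@ler_pM2l _ (16 * 4 ^+ n / pi ^+ 2)); last first.
  by rewrite divr_gt0// ?mulr_gt0 ?exprn_gt0// pi_gt0.
have -> : 16 * 4 ^+ n / pi ^+ 2 * (pi ^+ 2 / 8) = 2 * 4 ^+ n :> R.
  by move: (pi_gt0 R); move: (pi) => p p0; field; rewrite gt_eqF.
rewrite -sum_inv_sin2 big_distrr/= big_nat_cond [leRHS]big_nat_cond.
apply: ler_sum => k; rewrite andbT => /andP[_ kn].
have /andP[a0 a1] := odd_angle_bounds kn.
have s0 : 0 < sin (odd_angle n k) by apply: sin_gt0_pihalf; rewrite a0.
have -> : 16 * 4 ^+ n / pi ^+ 2 * (k.*2.+1%:R ^+ 2)^-1 = (odd_angle n k ^+ 2)^-1.
  rewrite /odd_angle !exprS expr0 mulr1.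
  have -> : 4 ^+ n = 2 ^+ n * 2 ^+ n :> R by rewrite -exprMn -natrM.
  move: (pi_gt0 R); move: (pi) => p p0.
  by field; rewrite (gt_eqF p0) expf_eq0 pnatr_eq0 andbF /= nat1r pnatr_eq0.
rewrite lef_pV2 ?posrE ?exprn_gt0// ler_pXn2r//; [|exact: ltW..].
by rewrite sin_le_id// ltW.
Qed.

(** The even terms up to 2 n make up a quarter of the sum up to n, so a sum S up
    to 2 n satisfies S <= pi^2 / 8 + S / 4. *)
Lemma sum_inv_squares_le n :
  \sum_(1 <= k < n.+1) (k%:R ^+ 2)^-1 <= pi ^+ 2 / 6 :> R.
Proof.
pose S n : R := \sum_(1 <= k < n.+1) (k%:R ^+ 2)^-1.
have S2 : S n.*2 = \sum_(0 <= k < n) (k.*2.+1%:R ^+ 2)^-1 + S n / 4.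
  rewrite /S; elim: n => [|n IH]; first by rewrite !big_nil; lra.
  rewrite doubleS [LHS]big_nat_recr//= [X in X + _ = _]big_nat_recr//= IH.
  rewrite [X in _ = X + _]big_nat_recr//= [X in _ = _ + X / 4]big_nat_recr//=.
  have -> : (n.*2.+2%:R ^+ 2)^-1 = ((n.+1)%:R ^+ 2)^-1 / 4 :> R.
    by rewrite -doubleS -muln2 natrM; field.
  by rewrite mulrDl -!addrA; congr (_ + _); rewrite addrCA.
have leS : S n <= S n.*2.
  rewrite /S [leRHS](@big_cat_nat _ _ _ n.+1)//=; last by rewrite ltnS -addnn leq_addr.
  by rewrite lerDl sumr_ge0//.
have := sum_inv_odd_squares_le n; rewrite -/(S n); lra.
Qed.

End Basel.

(** * Integrals against a conditional expectation *)

Section CondExp.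
Context (dsp : measure_display) (T : measurableType dsp) (R : realType).
Context (P : probability T R) (G : set (set T)).
Hypotheses (sG : sigma_algebra [set: T] G) (GT : G `<=` measurable).
Implicit Types (Y Z H : T -> R).

Lemma measurable_wrtE H :
  measurable_wrt G H <-> measurable_fun [set: g_sigma_algebraType G] H.
Proof.
split=> [GH _ B mB|GH B mB].
  by rewrite setTI; apply: sub_sigma_algebra; exact: GH.
by have := GH measurableT B mB; rewrite setTI /measurable/= sigma_algebra_id.
Qed.

Lemma measurable_wrt_sub H : measurable_wrt G H -> measurable_fun [set: T] H.
Proof. by move=> GH _ B mB; rewrite setTI; exact/GT/GH. Qed.

Import HBNNSimple.

(** H is an increasing limit of simple functions that are measurable with respect
    to G, and for such a function the claim is a finite combination of the
    inequalities over the events of G.  An inequality is what the next lemma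
    needs: it applies this one to the positive part of a conditional
    expectation, whose integrals over the events of G can only be larger. *)
Lemma ge0_le_integral_mul_wrt H Y Z :
  measurable_wrt G H -> (forall w, 0 <= H w) ->
  measurable_fun [set: T] Y -> (forall w, 0 <= Y w) ->
  measurable_fun [set: T] Z -> (forall w, 0 <= Z w) ->
  (forall A, G A ->
    (\int[P]_(w in A) (Y w)%:E <= \int[P]_(w in A) (Z w)%:E)%E) ->
  (\int[P]_w (H w * Y w)%:E <= \int[P]_w (H w * Z w)%:E)%E.
Proof.
move=> /measurable_wrtE GH H0 mY Y0 mZ Z0 YZ.
pose T' : measurableType _ := g_sigma_algebraType G.
have mH : measurable_fun [set: T'] (EFin \o (H : T' -> R)).
  exact/measurable_EFinP.
pose h := nnsfun_approx measurableT mH.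
have mh n : measurable_fun [set: T] (h n).
  by apply: measurable_wrt_sub; apply/measurable_wrtE; exact: measurable_funPT.
have h_int n (W : T -> R) : measurable_fun [set: T] W -> (forall w, 0 <= W w) ->
  (\int[P]_w (h n w * W w)%:E =
   \sum_(y \in range (h n)) y%:E * \int[P]_(w in h n @^-1` [set y]) (W w)%:E)%E.
  move=> mW W0.
  have mA y : measurable (h n @^-1` [set y] : set T).
    by rewrite -[X in measurable X]setTI; exact: mh.
  have mI y : measurable_fun [set: T] (\1_(h n @^-1` [set y] : set T) : T -> R).
    exact: measurable_indic.
  transitivity (\int[P]_w \sum_(y \in range (h n))
      (y * (\1_(h n @^-1` [set y]) w * W w))%:E)%E.
    apply: eq_integral => w _.
    rewrite fimfunE fsumEFin//; congr (_%:E).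
    rewrite !fsbig_finite//= mulr_suml; apply: eq_bigr => y _.
    by rewrite mulrA.
  rewrite ge0_integral_fsum//; last 2 first.
  - move=> y; apply/measurable_EFinP; apply: measurable_funM => //.
    by apply: measurable_funM => //; exact: mI.
  - move=> y w _; rewrite mulrA EFinM mule_ge0 ?lee_fin//.
    exact: nnfun_muleindic_ge0.
  apply: eq_fsbigr => y; rewrite inE => -[x _ <-].
  under eq_integral do rewrite EFinM.
  rewrite ge0_integralZl_EFin//; first last.
    apply/measurable_EFinP; apply: measurable_funM => //; exact: mI.
    by move=> w _; rewrite lee_fin mulr_ge0.
  congr (_ * _)%E; rewrite [RHS]integral_mkcond; apply: eq_integral => w _.
  by rewrite epatch_indic /= -EFinM mulrC.
have lim_int (W : T -> R) : measurable_fun [set: T] W -> (forall w, 0 <= W w) ->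
  (\int[P]_w (h n w * W w)%:E @[n --> \oo] --> \int[P]_w (H w * W w)%:E)%E.
  move=> mW W0; pose hW n w := (h n w * W w)%:E.
  rewrite (_ : \int[P]_w _ = \int[P]_w limn (hW ^~ w))%E.
    apply: cvg_monotone_convergence => //.
    - by move=> n; apply/measurable_EFinP; exact: measurable_funM.
    - by move=> n w _; rewrite lee_fin mulr_ge0.
    - move=> w _ i j ij; rewrite lee_fin ler_wpM2r//.
      by have /lefP := nd_nnsfun_approx measurableT mH ij; exact.
  apply: eq_integral => w _; apply/esym/cvg_lim => //.
  have hw : EFin \o h ^~ w @ \oo --> (H w)%:E.
    by apply: cvg_nnsfun_approx => // v _; rewrite lee_fin.
  have -> : hW ^~ w = (fun n => (h n w)%:E * (W w)%:E)%E.
    by apply/funext => n; rewrite -EFinM.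
  by rewrite EFinM; exact: cvgeZr.
have mG (A : set T') : measurable A -> G A.
  by rewrite /measurable/= sigma_algebra_id.
have := lim_int _ mZ Z0; have := lim_int _ mY Y0.
move=> /[dup] cY /cvg_lim <-// /[dup] cZ /cvg_lim <-//.
apply: lee_lim; [by apply: cvgP cY|by apply: cvgP cZ|].
apply: nearW => n; rewrite !h_int//; apply: lee_fsum => // y [x _ <-].
apply: lee_wpmul2l; first by rewrite lee_fin.
apply: YZ; apply: mG; exact: (measurable_funPTI (h n)).
Qed.

(** Conditionally on G the factor Y may be replaced by Z, and
    Z exp (1 - Z) <= 1. *)
Lemma exp_supermartingale_step H Y Z :
  measurable_wrt G H -> (forall w, 0 <= H w) ->
  measurable_fun [set: T] Y -> (forall w, 0 <= Y w) ->
  is_cond_exp P G Y Z ->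
  (\int[P]_w (H w * (Y w * expR (1 - Z w)))%:E <= \int[P]_w (H w)%:E)%E.
Proof.
move=> GH H0 mY Y0 [GZ iZ YZ].
have mZ := measurable_wrt_sub GZ.
pose K w := H w * expR (1 - Z w).
have K0 w : 0 <= K w by rewrite mulr_ge0.
have GK : measurable_wrt G K.
  apply/measurable_wrtE; apply: measurable_funM; first exact/measurable_wrtE.
  apply: measurableT_comp => //; apply: measurable_funB => //.
  exact/measurable_wrtE.
(* Z may be negative on a null set; its positive part is used instead. *)
apply: (@le_trans _ _ (\int[P]_w (K w * Num.max (Z w) 0)%:E)%E).
  rewrite (_ : (fun w => _) = (fun w => (K w * Y w)%:E)); last first.
    by apply/funext => w; rewrite /K mulrAC mulrA.
  apply: ge0_le_integral_mul_wrt => //.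
  - exact: measurable_maxr.
  - by move=> w; rewrite le_max lexx orbT.
  - move=> A GA; have mA : measurable A := GT GA.
    rewrite -YZ//; apply: le_integral => //.
    + exact: integrableS iZ.
    + apply: le_integrable (integrableS measurableT mA _ iZ) => //=; last first.
      * move=> w _; rewrite lee_fin ger0_norm ?le_max ?lexx ?orbT//.
        by rewrite ge_max ler_norm normr_ge0.
      * apply/measurable_EFinP; apply: measurable_funTS.
        exact: measurable_maxr.
    + by move=> w _; rewrite lee_fin le_max lexx.
apply: ge0_le_integral => //.
- by move=> w _; rewrite lee_fin mulr_ge0// le_max lexx orbT.
- apply/measurable_EFinP; apply: measurable_funM; last exact: measurable_maxr.
  exact: measurable_wrt_sub.
- by apply/measurable_EFinP; exact: measurable_wrt_sub.
- move=> w _; rewrite lee_fin /K -mulrA ler_piMr//.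
  rewrite -[1 - Z w]opprB expRN mulrC ler_pdivrMr ?expR_gt0// mul1r.
  by rewrite ge_max expR_ge0 andbT; have := expR_ge1Dx (Z w - 1); lra.
Qed.

Lemma is_cond_exp_cst (c : R) : is_cond_exp P G (fun=> c) (fun=> c).
Proof.
split=> //; first by apply/measurable_wrtE.
exact: finite_measure_integrable_cst.
Qed.

Lemma is_cond_expD Y1 Y2 Z1 Z2 :
  P.-integrable [set: T] (EFin \o Y1) -> P.-integrable [set: T] (EFin \o Y2) ->
  is_cond_exp P G Y1 Z1 -> is_cond_exp P G Y2 Z2 ->
  is_cond_exp P G (Y1 \+ Y2) (Z1 \+ Z2).
Proof.
move=> iY1 iY2 [GZ1 iZ1 E1] [GZ2 iZ2 E2]; split.
- by apply/measurable_wrtE; apply: measurable_funD; exact/measurable_wrtE.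
- exact: (integrableD measurableT iZ1 iZ2).
- move=> A GA; have mA : measurable A := GT GA.
  have h W := @integrableS _ _ _ P _ _ W measurableT mA (@subsetT _ A).
  under eq_integral do rewrite /= EFinD.
  under [RHS]eq_integral do rewrite /= EFinD.
  rewrite integralD//; [|exact: h..].
  by rewrite integralD//; [rewrite E1// E2//|exact: h..].
Qed.

Lemma is_cond_expZ (c : R) Y Z :
  P.-integrable [set: T] (EFin \o Y) -> is_cond_exp P G Y Z ->
  is_cond_exp P G (fun w => c * Y w) (fun w => c * Z w).
Proof.
move=> iY [GZ iZ YZ]; split.
- by apply/measurable_wrtE; apply: measurable_funM => //; exact/measurable_wrtE.
- exact: (integrableZl measurableT c iZ).
- move=> A GA; have mA : measurable A := GT GA.
  have h W := @integrableS _ _ _ P _ _ W measurableT mA (@subsetT _ A).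
  under eq_integral do rewrite EFinM.
  under [RHS]eq_integral do rewrite EFinM.
  by rewrite !integralZl ?YZ//; exact: h.
Qed.

End CondExp.

(** * An exponential supermartingale *)

Lemma measurable_sum_from1 (d : measure_display) (T : measurableType d)
    (R : realType) (f : nat -> T -> R) n :
  (forall t, (1 <= t)%N -> measurable_fun [set: T] (f t)) ->
  measurable_fun [set: T] (fun w => \sum_(1 <= t < n.+1) f t w).
Proof.
move=> mf; under eq_fun do rewrite big_add1 /=.
by apply: measurable_sum => t; exact: mf.
Qed.

Lemma ln_prod_from1 (R : realType) (f : nat -> R) n :
  (forall t, (1 <= t)%N -> 0 < f t) ->
  ln (\prod_(1 <= t < n.+1) f t) = \sum_(1 <= t < n.+1) ln (f t).
Proof.
move=> f0; elim: n => [|n IH]; first by rewrite !big_nil ln1.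
rewrite big_nat_recr//= [RHS]big_nat_recr//= lnM ?IH ?posrE ?f0//.
by rewrite big_nat_cond prodr_gt0// => t /andP[/andP[t1 _] _]; exact: f0.
Qed.

Lemma measurable_sum_ln1D_tail (d : measure_display) (T : measurableType d)
    (R : realType) (x a b : nat -> T -> R) n (K : R) :
  (forall t, (1 <= t)%N -> measurable_fun [set: T] (x t)) ->
  (forall t, (1 <= t)%N -> measurable_fun [set: T] (a t)) ->
  (forall t, (1 <= t)%N -> measurable_fun [set: T] (b t)) ->
  measurable [set w | (\sum_(1 <= t < n.+1) ln (1 + x t w) <=
      \sum_(1 <= t < n.+1) (a t w - 4 * b t w) - K)%R].
Proof.
move=> mx ma mb; rewrite -[X in measurable X]setTI; apply: measurable_fun_le => //.
  apply: measurable_sum_from1 => t t1; apply: measurableT_comp => //.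
  by apply: measurable_funD => //; exact: mx.
apply: measurable_funB => //; apply: measurable_sum_from1 => t t1.
apply: measurable_funB => //; first exact: ma.
by apply: measurable_funM => //; exact: mb.
Qed.

Section Supermartingale.
Context (dsp : measure_display) (T : measurableType dsp) (R : realType).
Context (P : probability T R) (F : nat -> set (set T)).
Hypothesis F_filtration : filtration F.

Let F_sigma t : sigma_algebra [set: T] (F t). Proof. by case: F_filtration. Qed.
Let F_sub t : F t `<=` measurable. Proof. by case: F_filtration. Qed.

Lemma filtration_wrt s t (H : T -> R) :
  (s <= t)%N -> measurable_wrt (F s) H -> measurable_wrt (F t) H.
Proof. by case: F_filtration => _ _ Fst st FH A mA; exact/(Fst _ _ st)/FH. Qed.

Let F_meas t (H : T -> R) : measurable_wrt (F t) H -> measurable_fun [set: T] H.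
Proof. exact: measurable_wrt_sub. Qed.

Section Product.
Variables Y Z : nat -> T -> R.
Hypothesis Y_adapted : forall t, (1 <= t)%N -> measurable_wrt (F t) (Y t).
Hypothesis Y_ge0 : forall t w, (1 <= t)%N -> 0 <= Y t w.
Hypothesis Z_cond : forall t, (1 <= t)%N -> is_cond_exp P (F t.-1) (Y t) (Z t).

(** A supermartingale for nonnegative adapted Y: one minus the conditional expectation plays the role of
    minus the log of the conditional expectation. *)
Definition compensated_product n w : R :=
  \prod_(1 <= t < n.+1) (Y t w * expR (1 - Z t w)).

Lemma compensated_product_ge0 n w : 0 <= compensated_product n w.
Proof.
rewrite /compensated_product big_nat_cond prodr_ge0// => t /andP[/andP[t1 _] _].
by rewrite mulr_ge0// Y_ge0.
Qed.

Lemma compensated_product_wrt n : measurable_wrt (F n) (compensated_product n).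
Proof.
elim: n => [|n IH].
  rewrite (_ : compensated_product 0 = (fun=> 1)).
    by apply/(measurable_wrtE (F_sigma 0)).
  by apply/funext => w; rewrite /compensated_product big_nil.
rewrite (_ : compensated_product n.+1 = (fun w => compensated_product n w *
   (Y n.+1 w * expR (1 - Z n.+1 w)))); last first.
  by apply/funext => w; rewrite /compensated_product big_nat_recr.
apply/(measurable_wrtE (F_sigma _)); apply: measurable_funM.
  by apply/(measurable_wrtE (F_sigma _)); exact: filtration_wrt IH.
apply: measurable_funM; first by apply/(measurable_wrtE (F_sigma _)); exact: Y_adapted.
apply: measurableT_comp => //; apply: measurable_funB => //.
apply/(measurable_wrtE (F_sigma _)); apply: (@filtration_wrt n) => //.
by have [] := @Z_cond n.+1 isT.
Qed.

Lemma integral_compensated_product_le1 n :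
  (\int[P]_w (compensated_product n w)%:E <= 1)%E.
Proof.
elim: n => [|n IH].
  under eq_integral do rewrite /compensated_product big_nil.
  by rewrite integral_cst// mul1e probability_le1.
apply: le_trans IH.
under eq_integral do rewrite /compensated_product big_nat_recr//=.
apply: (@exp_supermartingale_step _ _ _ P (F n) (F_sigma n) (@F_sub n)
  (compensated_product n) (Y n.+1) (Z n.+1)).
- exact: compensated_product_wrt.
- exact: compensated_product_ge0.
- by apply: F_meas; exact: Y_adapted.
- by move=> w; exact: Y_ge0.
- exact: (Z_cond (isT : (1 <= n.+1)%N)).
Qed.

Lemma compensated_product_tail n (c : R) : 0 < c ->
  (P [set w | (c <= compensated_product n w)%R] <= (c^-1)%:E)%E.
Proof.
move=> c0; have mM := F_meas (@compensated_product_wrt n).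
have mMe : measurable_fun [set: T] (EFin \o compensated_product n).
  exact/measurable_EFinP.
have := @le_integral_abse _ _ _ P _ measurableT _ c mMe c0.
under eq_integral do rewrite /= ger0_norm ?compensated_product_ge0//.
move=> /le_trans /(_ (integral_compensated_product_le1 n)).
rewrite (_ : _ `&` _ = [set w | (c <= compensated_product n w)%R]).
  by rewrite -lee_pdivlMl// mule1.
apply/seteqP; split => w /=.
  by rewrite lee_fin ger0_norm ?compensated_product_ge0// => -[].
by rewrite lee_fin ger0_norm ?compensated_product_ge0.
Qed.
End Product.

(** This is (1 + x)^(-1/2) <= 1 - x / 2 + 2 x^2 on [-1/2, 1/2], in logarithmic
    form.  The constant 2 is not sharp; squared, the bound becomes the
    factorisation displayed in the proof. *)
Lemma ln1D_quadratic (x y : R) : `|x| <= 1 / 2 -> 1 - x / 2 + 2 * x ^+ 2 <= y ->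
  - 2 * ln y <= ln (1 + x).
Proof.
rewrite ler_norml => /andP[x1 x2] xy.
have q0 : 0 < 1 - x / 2 + 2 * x ^+ 2 by nra.
have y0 : 0 < y by exact: lt_le_trans xy.
have x0 : 0 < 1 + x by lra.
have : 0 <= ln ((1 + x) * y ^+ 2).
  apply: ln_ge0; apply: (@le_trans _ _ ((1 + x) * (1 - x / 2 + 2 * x ^+ 2) ^+ 2)).
    rewrite -subr_ge0.
    have -> : (1 + x) * (1 - x / 2 + 2 * x ^+ 2) ^+ 2 - 1 =
      x ^+ 2 * (13 / 4 + 9 / 4 * x + 2 * x ^+ 2 + 4 * x ^+ 3) by field.
    rewrite mulr_ge0 ?sqr_ge0//; have : - 1 / 8 <= x ^+ 3 by nra.
    nra.
  by rewrite ler_pM2l// ler_pXn2r// ?nnegrE ltW.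
rewrite lnM ?posrE ?exprn_gt0// lnXn//; lra.
Qed.

(** With Y = 1 - x / 2 + 2 q and Z its conditional expectation 1 - a / 2 + 2 b,
    the sum of the ln (1 + x) is at least - 2 times that of the ln Y.  The event
    thus forces the sum of the ln Y + (1 - Z) above ln c, that is, the compensated
    product of Y above c. *)
Lemma sum_ln1D_tail (x q a b : nat -> T -> R) (n : nat) (K c : R) : 0 < c ->
  (forall t, (1 <= t)%N -> measurable_wrt (F t) (x t)) ->
  (forall t, (1 <= t)%N -> measurable_wrt (F t) (q t)) ->
  (forall t w, (1 <= t)%N -> `|x t w| <= 1 / 2) ->
  (forall t w, (1 <= t)%N -> x t w ^+ 2 <= q t w <= K) ->
  (forall t, (1 <= t)%N -> is_cond_exp P (F t.-1) (x t) (a t)) ->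
  (forall t, (1 <= t)%N -> is_cond_exp P (F t.-1) (q t) (b t)) ->
  (P [set w | (\sum_(1 <= t < n.+1) ln (1 + x t w) <=
      \sum_(1 <= t < n.+1) (a t w - 4 * b t w) - 2 * ln c)%R] <= (c^-1)%:E)%E.
Proof.
move=> c0 Fx Fq x2 xq xa qb.
pose Y t w := 1 + ((- (1 / 2)) * x t w + 2 * q t w).
pose Z t w := 1 + ((- (1 / 2)) * a t w + 2 * b t w).
have bd_int (W : T -> R) M : measurable_fun [set: T] W -> (forall w, `|W w| <= M) ->
    P.-integrable [set: T] (EFin \o W).
  move=> mW WM; apply: measurable_bounded_integrable => //.
    by rewrite ltey_eq fin_num_measure.
  exists M; split; first exact: num_real.
  by move=> M' MM' w _; exact: le_trans (WM w) (ltW MM').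
have ix t : (1 <= t)%N -> P.-integrable [set: T] (EFin \o x t).
  move=> t1; apply: (bd_int _ (1 / 2)); first exact/F_meas/Fx.
  by move=> w; exact: x2.
have iq t : (1 <= t)%N -> P.-integrable [set: T] (EFin \o q t).
  move=> t1; apply: (bd_int _ K); first exact/F_meas/Fq.
  move=> w; have /andP[h1 h2] := xq t w t1.
  by rewrite ger0_norm// (le_trans _ h1)// sqr_ge0.
have Yge t w : (1 <= t)%N -> 1 - x t w / 2 + 2 * x t w ^+ 2 <= Y t w.
  by move=> t1; have /andP[h1 _] := xq t w t1; rewrite /Y; lra.
have Y_gt0 t w : (1 <= t)%N -> 0 < Y t w.
  move=> t1; apply: lt_le_trans (Yge t w t1).
  by have := x2 t w t1; rewrite ler_norml => /andP[]; nra.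
have YZ t : (1 <= t)%N -> is_cond_exp P (F t.-1) (Y t) (Z t).
  move=> t1; apply: is_cond_expD => //.
  - exact: finite_measure_integrable_cst.
  - exact: (integrableD measurableT (integrableZl measurableT _ (ix t t1))
      (integrableZl measurableT _ (iq t t1))).
  - exact: is_cond_exp_cst.
  - apply: is_cond_expD => //.
    + exact: (integrableZl measurableT _ (ix t t1)).
    + exact: (integrableZl measurableT _ (iq t t1)).
    + by apply: is_cond_expZ => //; [exact: ix|exact: xa].
    + by apply: is_cond_expZ => //; [exact: iq|exact: qb].
have FY t : (1 <= t)%N -> measurable_wrt (F t) (Y t).
  move=> t1; apply/(measurable_wrtE (F_sigma t)).
  apply: measurable_funD => //; apply: measurable_funD;
    apply: measurable_funM => //; apply/(measurable_wrtE (F_sigma t)).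
  + exact: Fx.
  + exact: Fq.
apply: le_trans (compensated_product_tail FY (fun t w t1 => ltW (Y_gt0 t w t1)) YZ n c0).
apply: le_measure; rewrite ?inE.
- apply: measurable_sum_ln1D_tail => t t1; first exact/F_meas/Fx.
    by have [/F_meas] := xa t t1.
  by have [/F_meas] := qb t t1.
- rewrite -[X in measurable X]setTI; apply: measurable_fun_le => //.
  apply: F_meas; exact: compensated_product_wrt.
- move=> w /= hw; rewrite -ler_ln ?posrE//; last first.
    rewrite /compensated_product big_nat_cond prodr_gt0// => t /andP[/andP[t1 _] _].
    by rewrite mulr_gt0// ?Y_gt0 ?expR_gt0.
  rewrite /compensated_product ln_prod_from1; last first.
    by move=> t t1; rewrite mulr_gt0 ?Y_gt0 ?expR_gt0.
  have : - 2 * \sum_(1 <= t < n.+1) ln (Y t w) <= \sum_(1 <= t < n.+1) ln (1 + x t w).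
    rewrite big_distrr/= big_nat_cond [leRHS]big_nat_cond; apply: ler_sum => t.
    rewrite andbT => /andP[t1 _].
    by apply: ln1D_quadratic; [exact: x2|exact: Yge].
  move=> /le_trans /(_ hw).
  rewrite [X in ln c <= X](_ : _ = \sum_(1 <= t < n.+1) ln (Y t w) +
     2^-1 * \sum_(1 <= t < n.+1) (a t w - 4 * b t w)).
    move: (\sum_(_ <= _ < _) _) => A; move: (\sum_(_ <= _ < _) _) => A'; lra.
  rewrite big_distrr -big_split/=; apply: eq_big_nat => t /andP[t1 _].
  rewrite lnM ?posrE ?Y_gt0 ?expR_gt0// expRK; congr (_ + _).
  by rewrite /Z; field.
Qed.
End Supermartingale.

(** * Vectors *)

Section Vectors.
Variables (R : realType) (d : nat).
Implicit Types (x y gamma : 'rV[R]_d).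

Lemma dotvZl (a : R) x y : dotv (a *: x) y = a * dotv x y.
Proof. by rewrite /dotv big_distrr/=; apply: eq_bigr => i _; rewrite mxE mulrA. Qed.

Lemma dotvZr (a : R) x y : dotv x (a *: y) = a * dotv x y.
Proof. by rewrite /dotv big_distrr/=; apply: eq_bigr => i _; rewrite mxE mulrCA. Qed.

Lemma dotv_sumr (I : Type) (r : seq I) x (y : I -> 'rV[R]_d) :
  dotv x (\sum_(i <- r) y i) = \sum_(i <- r) dotv x (y i).
Proof.
rewrite /dotv exchange_big/=; apply: eq_bigr => i _.
by rewrite summxE big_distrr.
Qed.

Lemma coord_le_norm x i : `|x ord0 i| <= `|x|.
Proof.
rewrite [leRHS]/Num.norm/= mx_normrE.
exact: (le_bigmax _ (fun ij : 'I_1 * 'I_d => `|x ij.1 ij.2|) (ord0, i)).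
Qed.

Lemma norm_lt_coord x (e : R) : 0 < e -> (forall i, `|x ord0 i| < e) -> `|x| < e.
Proof.
move=> e0 xe; rewrite [ltLHS]/Num.norm/= mx_normrE; apply/bigmax_ltP; split=> //.
by case=> j i _; rewrite (ord1 j) xe.
Qed.

Lemma norm_attained x : (0 < d)%N -> exists i, `|x| = `|x ord0 i|.
Proof.
move=> d0; have [x0|/mx_norm_neq0[[j i] /= xi]] := eqVneq (mx_norm x) 0.
  exists (Ordinal d0); have {}x0 : `|x| = 0 by [].
  by apply/eqP; rewrite eq_le coord_le_norm x0 normr_ge0.
by exists i; rewrite [LHS]xi (ord1 j).
Qed.

Lemma dotv_ge0 x : 0 <= dotv x x.
Proof. by apply: sumr_ge0 => i _; rewrite -expr2 sqr_ge0. Qed.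

Lemma norm2_sqr x : norm2 x ^+ 2 = dotv x x.
Proof. by rewrite sqr_sqrtr// dotv_ge0. Qed.

Lemma dotv_signed_basis (i : 'I_(d + d)) x : dotv (signed_basis R i) x =
  match fintype.split i with inl j => x ord0 j | inr j => - x ord0 j end.
Proof.
have h (j : 'I_d) : dotv (delta_mx ord0 j) x = x ord0 j.
  rewrite /dotv (bigD1 j)//= mxE !eqxx mul1r big1 ?addr0// => k kj.
  by rewrite mxE (negbTE kj) andbF mul0r.
rewrite /signed_basis; case: fintype.split => j //.
by rewrite -scaleN1r dotvZl h mulN1r.
Qed.

Lemma normr_dotv_signed_basis i x : `|dotv (signed_basis R i) x| <= `|x|.
Proof.
by rewrite dotv_signed_basis; case: fintype.split => j; rewrite ?normrN coord_le_norm.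
Qed.

Lemma dotv_signed_basis_attained x :
  (0 < d)%N -> exists i : 'I_(d + d), dotv (signed_basis R i) x = `|x|.
Proof.
move=> d0; have [j xj] := norm_attained x d0.
have [x0|x0] := leP 0 (x ord0 j).
  exists (unsplit (inl j)); rewrite dotv_signed_basis unsplitK.
  by rewrite xj ger0_norm.
exists (unsplit (inr j)); rewrite dotv_signed_basis unsplitK.
by rewrite xj ltr0_norm.
Qed.

(** Cauchy-Schwarz, through the coordinatewise bound
    |a b| <= B^2 a^2 + b^2 / (2 B)^2.  When B = 0 the bound on gamma reads
    norm2 gamma <= 0 by the convention 0^-1 = 0, and x itself vanishes. *)
Lemma dotv_half (B : R) gamma x :
  norm2 gamma <= (2 * B)^-1 -> norm2 x <= B -> `|dotv gamma x| <= 1 / 2.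
Proof.
move=> gB xB; have B0 : 0 <= B by apply: le_trans xB; exact: sqrtr_ge0.
have [B_eq0|B_neq0] := eqVneq B 0.
  suff x0 i : x ord0 i = 0.
    by rewrite /dotv big1 ?normr0// => i _; rewrite x0 mulr0.
  have : dotv x x <= 0.
    by rewrite -sqrtr_eq0; apply/eqP/le_anti; rewrite sqrtr_ge0 andbT; move: xB; rewrite B_eq0.
  move=> xx0; have /eqP : dotv x x = 0 by apply/eqP; rewrite eq_le xx0 dotv_ge0.
  rewrite /dotv psumr_eq0 => [|j _]; last by rewrite -expr2 sqr_ge0.
  by move=> /allP/(_ i (mem_index_enum i))/=; rewrite -expr2 sqrf_eq0 => /eqP.
have {B_neq0}Bgt0 : 0 < B by rewrite lt_neqAle eq_sym B_neq0.
have g2 : dotv gamma gamma <= (2 * B)^-1 ^+ 2.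
  by rewrite -norm2_sqr ler_pXn2r// nnegrE ?sqrtr_ge0 ?invr_ge0 ?mulr_ge0.
have x2 : dotv x x <= B ^+ 2.
  by rewrite -norm2_sqr ler_pXn2r// nnegrE ?sqrtr_ge0.
apply: (@le_trans _ _ (B ^+ 2 * dotv gamma gamma + (2 * B)^-1 ^+ 2 * dotv x x)).
  rewrite /dotv !big_distrr -big_split/=.
  apply: le_trans (ler_norm_sum _ _ _) _; apply: ler_sum => i _.
  have := sqr_ge0 (B * gamma ord0 i - (2 * B)^-1 * x ord0 i).
  have := sqr_ge0 (B * gamma ord0 i + (2 * B)^-1 * x ord0 i).
  have : B * (2 * B)^-1 = 1 / 2 by field; exact: lt0r_neq0.
  move: ((2 * B)^-1) => C BC h1 h2; rewrite ler_norml; apply/andP.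
  by split; nra.
have : B * (2 * B)^-1 = 1 / 2 by field; exact: lt0r_neq0.
move: ((2 * B)^-1) g2 => C g2 BC.
have h1 : B ^+ 2 * dotv gamma gamma <= B ^+ 2 * C ^+ 2 by rewrite ler_pM2l// exprn_gt0.
have h2 : C ^+ 2 * dotv x x <= C ^+ 2 * B ^+ 2 by rewrite ler_wpM2l// sqr_ge0.
have : B ^+ 2 * C ^+ 2 = 1 / 4 by rewrite -exprMn BC; field.
by lra.
Qed.

Lemma norm2_le_sqrt x : norm2 x <= Num.sqrt d%:R * `|x|.
Proof.
rewrite -[`|x|]ger0_norm// -sqrtr_sqr -sqrtrM// ler_wsqrtr//.
have -> : d%:R * `|x| ^+ 2 = \sum_(i < d) `|x| ^+ 2.
  by rewrite sumr_const card_ord mulr_natl.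
apply: ler_sum => i _.
rewrite -expr2 -real_normK ?num_real//.
by rewrite ler_pXn2r// ?nnegrE// coord_le_norm.
Qed.

Lemma dotv_continuous x : continuous (fun gamma : 'rV[R]_d => dotv gamma x).
Proof.
rewrite /dotv; apply: continuous_big => [|i _]; first exact: add_continuous.
move=> gamma.
apply: (@continuousM _ _ (fun g : 'rV[R]_d => g ord0 i) (fun=> x ord0 i)).
  exact: coord_continuous.
exact: cst_continuous.
Qed.

(** Enumerate the rational points q and the radii 1 / (k + 1), and choose a point
    of A in each ball that meets A. *)
Lemma dense_sequence_in (A : set 'rV[R]_d) : A !=set0 ->
  exists2 s : nat -> 'rV[R]_d, forall k, A (s k) &
    forall gamma, A gamma -> forall U, nbhs gamma U -> exists k, U (s k).
Proof.
move=> [a0 Aa0].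
pose near_point (i : 'rV[rat]_d * nat) : set 'rV[R]_d :=
  [set y | A y /\ `|map_mx ratr i.1 - y| < i.2.+1%:R^-1].
exists (fun k => if unpickle k is Some i then xget a0 (near_point i) else a0).
  by move=> k; case: unpickle => [i|//]; case: xgetP => [y _ []|].
move=> gamma Ag U /nbhs_ballP[e /= e0 eU].
have [k] := ltr_add_invr (divr_gt0 e0 (ltr0Sn R 1)); rewrite add0r => ke.
have hq i : exists q : rat, `|ratr q - gamma ord0 i| < k.+1%:R^-1.
  have [q] := @rat_in_itvoo R (gamma ord0 i) (gamma ord0 i + k.+1%:R^-1)
    ltac:(by rewrite ltrDl invr_gt0).
  rewrite in_itv/= => /andP[q1 q2]; exists q.
  by rewrite ger0_norm ?subr_ge0 ?ltW// ltrBlDl.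
have [q qP] := choice hq.
pose i : 'rV[rat]_d * nat := (\row_j q j, k).
have iN : near_point i gamma.
  split=> //=; apply: norm_lt_coord => [|j]; first by rewrite invr_gt0.
  by rewrite !mxE.
exists (pickle i); rewrite pickleK; apply: eU.
have [_ /= h] := xgetPex a0 (ex_intro _ gamma iN).
have [_ /= h'] := iN.
rewrite -ball_normE/= /ball_/=.
rewrite -(subrKA (map_mx ratr (\row_j q j))); apply: le_lt_trans (ler_normD _ _) _.
by rewrite distrC [e]splitr; apply: ltrD; apply: lt_trans ke.
Qed.
End Vectors.

Lemma measurable_set_lt (dsp : measure_display) (T : measurableType dsp)
    (R : realType) (f h : T -> R) :
  measurable_fun [set: T] f -> measurable_fun [set: T] h ->
  measurable [set w | f w < h w].
Proof.
move=> mf mh; have mtrue : measurable [set true] by [].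
by have := measurable_fun_ltr mf mh measurableT mtrue; rewrite setTI.
Qed.

(** * Wealth and regret *)

Section Wealth.
Context (dsp : measure_display) (T : measurableType dsp) (R : realType).
Variables (d : nat) (X g : nat -> T -> 'rV[R]_d) (Gamma : set 'rV[R]_d).
Hypothesis dot_half : forall gamma t w, Gamma gamma -> `|dotv gamma (X t w)| <= 1 / 2.
Hypothesis X_meas : forall t i, measurable_fun [set: T] (fun w => X t w ord0 i).
Hypothesis g_meas : forall t i, (1 <= t)%N -> measurable_fun [set: T] (fun w => g t w ord0 i).
Hypothesis g_valued : forall t w, (1 <= t)%N -> Gamma (g t w).

Let factor_gt0 gamma t w : Gamma gamma -> 0 < 1 + dotv gamma (X t w).
Proof. by move=> /(dot_half t w); rewrite ler_norml => /andP[]; lra. Qed.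

Lemma wealth_gt0 n w : 0 < wealth X g n w.
Proof.
rewrite /wealth big_nat_cond prodr_gt0// => t /andP[/andP[t1 _] _].
exact/factor_gt0/g_valued.
Qed.

Lemma const_wealth_gt0 gamma n w : Gamma gamma -> 0 < const_wealth X gamma n w.
Proof. by move=> Gg; rewrite prodr_gt0// => t _; exact: factor_gt0. Qed.

Lemma has_ubound_ln_const_wealth n w :
  has_ubound [set ln (const_wealth X gamma n w) | gamma in Gamma].
Proof.
exists (ln ((3 / 2) ^+ n)) => _ [gamma Gg <-].
rewrite ler_ln ?posrE ?const_wealth_gt0 ?exprn_gt0//.
have -> : (3 / 2) ^+ n = \prod_(1 <= t < n.+1) (3 / 2) :> R.
  by rewrite prodr_const_nat subn1.
apply: ler_prod => t _.
rewrite ltW ?factor_gt0//=.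
by have := dot_half t w Gg; rewrite ler_norml => /andP[]; lra.
Qed.

Lemma ln_const_wealth_le_regret gamma n w : Gamma gamma ->
  ln (const_wealth X gamma n w) - ln (wealth X g n w) <= regret X g Gamma n w.
Proof.
move=> Gg; rewrite lerD2r; apply: ub_le_sup; first exact: has_ubound_ln_const_wealth.
by exists gamma.
Qed.

(** A supremum exceeds a number exactly when some member of the set does, whether
    or not it is attained.  In this form, free of logarithms, the condition on
    gamma is polynomial. *)
Lemma regret_gtP (r : R) n w : r < regret X g Gamma n w <->
  exists2 gamma, Gamma gamma &
    expR r * wealth X g n w < const_wealth X gamma n w.
Proof.
have lnE gamma : Gamma gamma ->
    (expR r * wealth X g n w < const_wealth X gamma n w) =
    (r + ln (wealth X g n w) < ln (const_wealth X gamma n w)).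
  move=> Gg; have W0 := wealth_gt0 n w; have L0 := const_wealth_gt0 n w Gg.
  rewrite -[in RHS](expRK r) -lnM ?posrE ?expR_gt0//.
  by rewrite ltr_ln ?posrE ?mulr_gt0 ?expR_gt0.
have g1 := g_valued w (isT : (1 <= 1)%N).
split=> [|[gamma Gg]].
  rewrite ltrBrDr => /sup_gt[|_ [gamma Gg <-]].
    by exists (ln (const_wealth X (g 1%N w) n w)); exists (g 1%N w).
  by rewrite -lnE//; exists gamma.
rewrite lnE// -ltrBrDr => /lt_le_trans; apply.
exact: ln_const_wealth_le_regret.
Qed.

Lemma measurable_dotv t (gamma : T -> 'rV[R]_d) :
  (forall i, measurable_fun [set: T] (fun w => gamma w ord0 i)) ->
  measurable_fun [set: T] (fun w => dotv (gamma w) (X t w)).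
Proof. by move=> mg; apply: measurable_sum => i; exact: measurable_funM. Qed.

Lemma measurable_const_wealth gamma n :
  measurable_fun [set: T] (const_wealth X gamma n).
Proof.
apply: measurable_prod => t _; apply: measurable_funD => //.
by apply: measurable_dotv.
Qed.

Lemma measurable_wealth n : measurable_fun [set: T] (wealth X g n).
Proof.
rewrite /wealth; under eq_fun do rewrite big_add1 /=.
apply: measurable_prod => t _; apply: measurable_funD => //.
by apply: measurable_dotv => i; exact: g_meas.
Qed.

Lemma const_wealth_continuous n w :
  continuous (fun gamma : 'rV[R]_d => const_wealth X gamma n w).
Proof.
rewrite /const_wealth; apply: continuous_big => [|t _]; first exact: mul_continuous.
move=> gamma.
have c1 : {for gamma, continuous (fun _ : 'rV[R]_d => 1 : R)}.
  exact: cst_continuous.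
exact: (continuousD c1 (@dotv_continuous _ _ (X t w) gamma)).
Qed.

(** By continuity of the constant wealth in the bet, the bets that witness a large
    regret can be taken in a fixed countable dense part of Gamma. *)
Lemma measurable_regret_gt (r : R) n :
  measurable [set w | r < regret X g Gamma n w].
Proof.
have [G0|] := pselect (Gamma !=set0); last first.
  move=> G0; rewrite (_ : [set _ | _] = set0)//.
  by apply/seteqP; split=> // w _; apply: G0; exists (g 1%N w); exact: g_valued.
have [s sG sd] := dense_sequence_in G0.
rewrite (_ : [set _ | _] = \bigcup_k
    [set w | expR r * wealth X g n w < const_wealth X (s k) n w]).
  apply: bigcupT_measurable => k; apply: measurable_set_lt => //; last first.
    exact: measurable_const_wealth.
  by apply: measurable_funM => //; exact: measurable_wealth.
apply/seteqP; split=> w /=.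
  move=> /regret_gtP[gamma Gg h].
  have := sd _ Gg [set gamma' | expR r * wealth X g n w < const_wealth X gamma' n w].
  case=> [|k hk]; last by exists k.
  exact: (@const_wealth_continuous n w gamma _ (open_nbhs_nbhs (conj (@open_gt _ _) h))).
by move=> [k _ hk]; apply/regret_gtP; exists (s k).
Qed.
End Wealth.

(** * Consequences of a summable tail *)

(** The integral of a nonnegative function is a supremum over the simple functions
    below it, hence monotone also for functions that are not known to be
    measurable; the hitting time is bounded in this way. *)
Lemma integral_mono_ge0 (dsp : measure_display) (T : measurableType dsp)
    (R : realType) (mu : {measure set T -> \bar R}) (f h : T -> \bar R) :
  (forall w, 0 <= f w)%E -> (forall w, f w <= h w)%E ->
  (\int[mu]_w f w <= \int[mu]_w h w)%E.
Proof.
move=> f0 fh; have h0 w : (0 <= h w)%E by exact: le_trans (f0 w) (fh w).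
rewrite !ge0_integralTE//; apply: ereal_sup_le => _ [s sf <-].
by exists s => // w; exact: le_trans (sf w) (fh w).
Qed.

Section Growth.
Context (dsp : measure_display) (T : measurableType dsp) (R : realType).
Variables (P : probability T R) (W : nat -> T -> R) (u : nat -> R) (c : \bar R).
Hypothesis W_gt0 : forall n w, 0 < W n w.
Hypothesis W_meas : forall n, measurable_fun [set: T] (W n).
Hypothesis tail_le :
  (\sum_(1 <= n <oo) P [set w | (ln (W n w) < u n)%R] <= c)%E.
Hypothesis c_fin : (c < +oo)%E.

(** Empty at 0, so that series over all n start in effect at n = 1. *)
Definition below n : set T := if n is 0 then set0 else [set w | ln (W n w) < u n].

Lemma measurable_below n : measurable (below n).
Proof.
case: n => [|n] //=; rewrite (_ : [set _ | _] = [set w | W n.+1 w < expR (u n.+1)]).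
  exact: measurable_set_lt.
have lnE w : (ln (W n.+1 w) < u n.+1) = (W n.+1 w < expR (u n.+1)).
  by rewrite -ltr_expR lnK// posrE.
by apply/seteqP; split=> w /=; rewrite lnE.
Qed.

Lemma sum_below_le : (\sum_(n <oo) P (below n) <= c)%E.
Proof.
rewrite nneseries_recl//= measure0 add0e; apply: le_trans tail_le.
by apply: lee_nneseries => // -[|n] _ //=; rewrite measure0.
Qed.

(** Borel-Cantelli: almost surely W n is below exp (u n) finitely often. *)
Lemma ae_liminf_ratio_ge1 : (\forall n \near \oo, 0 < u n) ->
  {ae P, forall w, (1%:E <= limn_einf (fun n => (ln (W n w) / u n)%:E))%E}.
Proof.
move=> [N0 _ u0]; exists (lim_sup_set below); split.
- by apply: bigcap_measurable => // n _; apply: bigcup_measurable => j _; exact: measurable_below.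
- apply: lim_sup_set_cvg0; first exact: measurable_below.
  exact: le_lt_trans sum_below_le c_fin.
- move=> w /= h; apply: contrapT => nlim; apply: h.
  have [N hN] : exists N, forall j, (N <= j)%N -> ~ below j w.
    apply: contrapT => hN; apply: nlim => N _.
    apply: contrapT => h; apply: hN; exists N => j Nj bj; apply: h.
    by exists j.
  rewrite limn_einf_lim; apply: lime_ge; first exact: is_cvg_einfs.
  exists (maxn 1 (maxn N N0)) => // n /=; rewrite !geq_max => /and3P[n1 nN nN0].
  apply: le_ereal_inf_tmp => _ [k /= nk <-].
  have uk : 0 < u k by apply: u0; exact: leq_trans nN0 nk.
  rewrite lee_fin ler_pdivlMr// mul1r leNgt; apply/negP => Wu.
  apply: (hN k (leq_trans nN nk)); rewrite /below.
  by move: (leq_trans n1 nk) Wu; case: k {nk uk}.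
Qed.

(** Every n with N <= n < hitting time has ln (W n) < ln (1 / alpha) <= u n, so
    it is counted by the series. *)
Lemma hitting_time_le (alpha : R) (N : nat) w : 0 < alpha -> (1 <= N)%N ->
  (forall k, (N <= k)%N -> ln (alpha^-1) <= u k) ->
  (hitting_time W alpha w <=
   N%:R%:E + \sum_(n <oo) (\1_(if (N <= n)%N then below n else set0) w)%:E)%E.
Proof.
move=> a0 N1 uN; set S := (X in (_ <= _ + X)%E).
have partial M : (N <= M)%N -> (forall n, (N <= n < M)%N -> W n w < alpha^-1) ->
    (M%:R%:E <= N%:R%:E + S)%E.
  move=> NM hM; rewrite -{1}(subnKC NM) natrD EFinD leeD2l//.
  apply: le_trans (nneseries_lim_ge M _); last by move=> n _ _; rewrite lee_fin.
  rewrite (big_cat_nat (leq0n N) NM)/=.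
  rewrite -[leLHS]add0e; apply: leeD; first by apply: sume_ge0 => n _; rewrite lee_fin.
  rewrite sumEFin lee_fin -[(M - N)%N]muln1 natrM mulrC mulr_natr -sumr_const_nat.
  rewrite big_nat_cond [leRHS]big_nat_cond; apply: ler_sum => n.
  rewrite andbT => /andP[Nn nM]; rewrite Nn indicE mem_set//.
  move: (leq_trans N1 Nn) (hM n); rewrite Nn nM => n1 /(_ isT) hW.
  rewrite /below; case: n Nn nM n1 hW => //= n Nn _ _ hW.
  by apply: lt_le_trans (uN _ Nn); rewrite ltr_ln ?posrE ?invr_gt0.
have [[n [Nn hn]]|none] := pselect (exists n, (N <= n)%N /\ alpha^-1 <= W n w).
  have ex : exists n, (N <= n)%N && (alpha^-1 <= W n w) by exists n; rewrite Nn.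
  case: (ex_minnP ex) => M /andP[NM hM] minM.
  apply: (@le_trans _ _ M%:R%:E).
    by apply: ereal_inf_lbound; exists M.
  apply: partial => // k /andP[Nk kM]; rewrite ltNge; apply/negP => hk.
  by have := minM k; rewrite Nk hk => /(_ isT); rewrite leqNgt kM.
suff -> : (N%:R%:E + S = +oo)%E by rewrite leey.
apply/eqyP => A A0.
apply: (@le_trans _ _ (maxn N (Num.bound A))%:R%:E); last first.
  apply: partial; first exact: leq_maxl.
  move=> n /andP[Nn _]; rewrite ltNge; apply/negP => hn.
  by apply: none; exists n.
rewrite lee_fin; apply: ltW; apply: lt_le_trans (archi_boundP (ltW A0)) _.
by rewrite ler_nat leq_maxr.
Qed.

Lemma expected_hitting_time_le (alpha : R) : 0 < alpha ->
  (\int[P]_w hitting_time W alpha w <= c + aleph u (ln (alpha^-1)))%E.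
Proof.
move=> a0.
have c0 : (0 <= c)%E.
  by apply: le_trans tail_le; apply: nneseries_ge0.
rewrite /aleph; set A := (X in image X).
have [[n0 An0]|noA] := pselect (A !=set0); last first.
  rewrite (_ : ereal_inf _ = +oo%E); last first.
    rewrite (_ : [set _ | _ in A] = set0) ?ereal_inf0//.
    by apply/seteqP; split=> // x [n An _]; apply: noA; exists n.
  by rewrite addey ?leey// gt_eqF// (lt_le_trans _ c0)// ltNyr.
have ex : exists n, `[< A n >] by exists n0; apply/asboolP.
case: (ex_minnP ex) => N /asboolP[N1 NA] minN.
have uN k : (N <= k)%N -> ln (alpha^-1) <= u k.
  by move=> Nk; rewrite -lee_fin (le_trans NA)//; apply: ereal_inf_lbound; exists k.
apply: (@le_trans _ _ (c + N%:R%:E)%E); last first.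
  apply: leeD => //; apply: le_ereal_inf_tmp => _ [n An <-].
  by rewrite lee_fin ler_nat minN//; apply/asboolP.
pose b n := if (N <= n)%N then below n else set0.
have mb n : measurable (b n) by rewrite /b; case: ifP => // _; exact: measurable_below.
have m1 n : measurable_fun [set: T] (fun w => (\1_(b n) w)%:E : \bar R).
  by apply/measurable_EFinP; exact: measurable_indic.
apply: (@le_trans _ _ (\int[P]_w (N%:R%:E + \sum_(n <oo) (\1_(b n) w)%:E))%E).
  apply: integral_mono_ge0 => w; last exact: hitting_time_le.
  by apply: le_ereal_inf_tmp => _ [n _ <-]; rewrite lee_fin.
have sum0 w : (0 <= \sum_(n <oo) (\1_(b n) w)%:E :> \bar R)%E.
  by apply: nneseries_ge0 => n _ _; rewrite lee_fin.
rewrite ge0_integralD//; last first.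
  by apply: ge0_emeasurable_sum => // n w _ _; rewrite lee_fin.
rewrite integral_cst// addeC; apply: leeD; last first.
  by rewrite -[leRHS]mule1 lee_wpmul2l ?lee_fin// probability_le1.
rewrite integral_nneseries//.
apply: le_trans sum_below_le; apply: lee_nneseries => [n _ _|n _].
  by apply: integral_ge0 => w _; rewrite lee_fin.
by rewrite integral_indic// setIT /b; case: ifP => // _; rewrite measure0.
Qed.

Lemma growth_conclusions_of_tail : growth_conclusions P W u c.
Proof.
split=> //; first exact: ae_liminf_ratio_ge1.
by move=> alpha /andP[a0 _]; exact: expected_hitting_time_le.
Qed.
End Growth.

(** * The tail of the wealth *)

Lemma measurable_mxnorm (dsp : measure_display) (T : measurableType dsp)
    (R : realType) (d : nat) (Y : T -> 'rV[R]_d) :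
  (forall i, measurable_fun [set: T] (fun w => Y w ord0 i)) ->
  measurable_fun [set: T] (fun w => `|Y w|).
Proof.
move=> mY; under eq_fun do rewrite [`|_|]/Num.norm/= mx_normrE.
elim: (index_enum _) => [|[j i] s IH].
  under eq_fun do rewrite big_nil; exact: measurable_cst.
under eq_fun do rewrite big_cons /=.
apply: measurable_maxr => //; apply: measurableT_comp => //.
by rewrite (ord1 j); exact: mY.
Qed.

Lemma measure_bigsetU_le (dsp : measure_display) (T : measurableType dsp)
    (R : realType) (P : probability T R) (I : Type) (s : seq I) (E : I -> set T) :
  (forall i, measurable (E i)) ->
  (P (\big[setU/set0]_(i <- s) E i) <= \sum_(i <- s) P (E i))%E.
Proof.
move=> mE; elim: s => [|i s IH]; first by rewrite !big_nil measure0.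
rewrite !big_cons; apply: le_trans (leeD2l _ IH).
by apply: measureU2 => //; exact: bigsetU_measurable.
Qed.

Lemma is_cond_exp_dotv (dsp : measure_display) (T : measurableType dsp)
    (R : realType) (P : probability T R) (G : set (set T)) (d : nat)
    (Y Z : T -> 'rV[R]_d) (gamma : 'rV[R]_d) :
  sigma_algebra [set: T] G -> G `<=` measurable ->
  (forall i, P.-integrable [set: T] (fun w => (Y w ord0 i)%:E)) ->
  is_cond_expv P G Y Z ->
  is_cond_exp P G (fun w => dotv gamma (Y w)) (fun w => dotv gamma (Z w)).
Proof.
move=> sG GT iY YZ; rewrite /dotv.
suff [] : P.-integrable [set: T]
      (EFin \o (fun w => \sum_(i < d) gamma ord0 i * Y w ord0 i)) /\
    is_cond_exp P G (fun w => \sum_(i < d) gamma ord0 i * Y w ord0 i)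
      (fun w => \sum_(i < d) gamma ord0 i * Z w ord0 i) by [].
elim: (index_enum _) => [|i s [IH1 IH2]].
  have -> : (fun w => \sum_(i <- [::]) gamma ord0 i * Y w ord0 i) = (fun=> 0).
    by apply/funext => w; rewrite big_nil.
  have -> : (fun w => \sum_(i <- [::]) gamma ord0 i * Z w ord0 i) = (fun=> 0).
    by apply/funext => w; rewrite big_nil.
  by split; [exact: finite_measure_integrable_cst|exact: is_cond_exp_cst].
have h (V : T -> 'rV[R]_d) :
    (fun w => \sum_(k <- i :: s) gamma ord0 k * V w ord0 k) =
    (fun w => gamma ord0 i * V w ord0 i) \+
    (fun w => \sum_(k <- s) gamma ord0 k * V w ord0 k).
  by apply/funext => w; rewrite big_cons.
rewrite !h; have iZ := integrableZl measurableT (gamma ord0 i) (iY i).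
split; first exact: (integrableD measurableT iZ IH1).
apply: is_cond_expD => //.
exact: (is_cond_expZ sG GT (gamma ord0 i) (iY i) (YZ i)).
Qed.

Section WealthTail.
Context (R : realType) (d : nat) (dsp : measure_display) (T : measurableType dsp).
Context (P : probability T R) (F : nat -> set (set T)).
Variables (XX Gamma : set 'rV[R]_d) (B : R) (X EX g : nat -> T -> 'rV[R]_d).
Variables (EN : nat -> T -> R).
Hypothesis d_ge1 : (1 <= d)%N.
Hypothesis F_filtration : filtration F.
Hypothesis XX_bounded : bounded_set XX.
Hypothesis B_def : B = sup [set norm2 x | x in XX].
Hypothesis X_adapted : adapted F X.
Hypothesis X_valued : forall t w, XX (X t w).
Hypothesis EX_cond : forall t, (1 <= t)%N -> is_cond_expv P (F t.-1) (X t) (EX t).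
Hypothesis EN_cond : forall t, (1 <= t)%N ->
  is_cond_exp P (F t.-1) (fun w => `|X t w| ^+ 2) (EN t).
Hypothesis Gamma_bounded : forall x, Gamma x -> norm2 x <= (2 * B)^-1.
Hypothesis g_predictable : predictable F g.
Hypothesis g_valued : forall n w, (1 <= n)%N -> Gamma (g n w).

Let F_sigma t : sigma_algebra [set: T] (F t). Proof. by case: F_filtration. Qed.
Let F_sub t : F t `<=` measurable. Proof. by case: F_filtration. Qed.

Let X_meas t i : measurable_fun [set: T] (fun w => X t w ord0 i).
Proof. by apply: (measurable_wrt_sub (@F_sub t)); exact: X_adapted. Qed.

Let g_meas t i : (1 <= t)%N -> measurable_fun [set: T] (fun w => g t w ord0 i).
Proof.
by case: t => // t _; apply: (measurable_wrt_sub (@F_sub t)); exact: g_predictable.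
Qed.

Lemma process_norm_bound : exists K, forall t w, `|X t w| <= K.
Proof.
have [M [_ hM]] := XX_bounded; exists (M + 1) => t w.
by apply: hM (X_valued t w); rewrite ltrDl.
Qed.

Lemma norm2_process_le t w : norm2 (X t w) <= B.
Proof.
rewrite B_def; apply: ub_le_sup; last by exists (X t w).
have [M [_ hM]] := XX_bounded; exists (Num.sqrt d%:R * (M + 1)) => _ [x Xx <-].
apply: le_trans (norm2_le_sqrt x) _; rewrite ler_wpM2l ?sqrtr_ge0//.
by apply: hM Xx; rewrite ltrDl.
Qed.

Let dot_half gamma t w : Gamma gamma -> `|dotv gamma (X t w)| <= 1 / 2.
Proof.
move=> Gg; apply: (@dotv_half _ _ B); first exact: Gamma_bounded.
exact: norm2_process_le.
Qed.

Lemma wealth_process_gt0 n w : 0 < wealth X g n w.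
Proof. exact: (wealth_gt0 dot_half g_valued). Qed.

Lemma measurable_wealth_process n : measurable_fun [set: T] (wealth X g n).
Proof. exact: measurable_wealth. Qed.

Let X_int t i : P.-integrable [set: T] (fun w => (X t w ord0 i)%:E).
Proof.
have [K hK] := process_norm_bound.
apply: measurable_bounded_integrable => //; first by rewrite ltey_eq fin_num_measure.
exists K; split; first exact: num_real.
move=> M KM w _; apply: le_trans (ltW KM); apply: le_trans (hK t w).
exact: coord_le_norm.
Qed.

Let EX_meas t i : (1 <= t)%N -> measurable_fun [set: T] (fun w => EX t w ord0 i).
Proof.
by move=> t1; have [h _ _] := EX_cond t1 i; exact: (measurable_wrt_sub (@F_sub t.-1)).
Qed.

Let EN_meas t : (1 <= t)%N -> measurable_fun [set: T] (EN t).
Proof.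
by move=> t1; have [h _ _] := EN_cond t1; exact: (measurable_wrt_sub (@F_sub t.-1)).
Qed.

Let N_int t : P.-integrable [set: T] (EFin \o (fun w => `|X t w| ^+ 2)).
Proof.
have [K hK] := process_norm_bound.
apply: measurable_bounded_integrable => //; first by rewrite ltey_eq fin_num_measure.
  by apply: measurable_funX; exact: measurable_mxnorm.
exists (K ^+ 2); split; first exact: num_real.
move=> M KM w _; apply: le_trans (ltW KM).
rewrite ger0_norm ?sqr_ge0// ler_pXn2r// nnegrE//.
exact: le_trans (hK t w).
Qed.

(** If the regret is at most r and the empirical conditions on the conditional
    moments hold, then a log-wealth below u makes the constant bet in the best
    direction fall in the exceptional event of sum_ln1D_tail at c = 2 d n^2.
    The best direction is random, whence the union over all 2 d of them. *)
Lemma wealth_tail (eps r m v u : R) (n : nat) : (1 <= n)%N ->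
  0 <= eps -> (forall i, Gamma (eps *: signed_basis R i)) ->
  0 <= m ->
  u <= n%:R * eps * m - 4 * n%:R * eps ^+ 2 * v - r - 2 * ln ((2 * d * n ^ 2)%N%:R) ->
  (P [set w | (ln (wealth X g n w) < u)%R] <=
   P [set w | (r < regret X g Gamma n w)%R] +
   P [set w | (`|meanv EX n w| < m)%R \/ (v < mean EN n w)%R] +
   ((n%:R ^+ 2)^-1)%:E)%E.
Proof.
move=> n1 eps0 Geps m0 hu.
have n0 : 0 < n%:R :> R by rewrite ltr0n.
pose gam i : 'rV[R]_d := eps *: signed_basis R i.
pose c : R := (2 * d * n ^ 2)%N%:R.
have c0 : 0 < c by rewrite ltr0n; nia.
pose E i := [set w | (\sum_(1 <= t < n.+1) ln (1 + dotv (gam i) (X t w)) <=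
  \sum_(1 <= t < n.+1) (dotv (gam i) (EX t w) - 4 * (eps ^+ 2 * EN t w)) -
    2 * ln c)%R].
have [K hK] := process_norm_bound.
have mE i : measurable (E i).
  apply: measurable_sum_ln1D_tail => t t1.
  - exact: measurable_dotv.
  - by apply: measurable_sum => j; apply: measurable_funM => //; exact: EX_meas.
  - by apply: measurable_funM => //; exact: EN_meas.
have PE i : (P (E i) <= (c^-1)%:E)%E.
  apply: (@sum_ln1D_tail _ _ _ P F F_filtration _
    (fun t w => eps ^+ 2 * `|X t w| ^+ 2) _ _ n (eps ^+ 2 * K ^+ 2)) => //.
  - move=> t _; apply/(measurable_wrtE (F_sigma t)).
    apply: measurable_sum => j; apply: measurable_funM => //.
    by apply/(measurable_wrtE (F_sigma t)); exact: X_adapted.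
  - move=> t _; apply/(measurable_wrtE (F_sigma t)).
    apply: measurable_funM => //; apply: measurable_funX.
    apply: measurable_mxnorm => j.
    by apply/(measurable_wrtE (F_sigma t)); exact: X_adapted.
  - by move=> t w _; exact: dot_half (Geps i).
  - move=> t w _; rewrite dotvZl exprMn; apply/andP; split.
      rewrite ler_wpM2l ?sqr_ge0// -[leLHS]real_normK ?num_real//.
      by rewrite ler_pXn2r// ?nnegrE// normr_dotv_signed_basis.
    rewrite ler_wpM2l ?sqr_ge0// ler_pXn2r// nnegrE//.
    exact: le_trans (hK t w).
  - move=> t t1.
    exact: (is_cond_exp_dotv (gam i) (F_sigma _) (@F_sub _) (X_int t) (EX_cond t1)).
  - move=> t t1; exact: (is_cond_expZ (F_sigma _) (@F_sub _) _ (N_int t) (EN_cond t1)).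
have PU : (P (\big[setU/set0]_i E i) <= ((n%:R ^+ 2)^-1)%:E)%E.
  apply: le_trans (measure_bigsetU_le _ _ mE) _.
  apply: le_trans (lee_sum _ (fun i _ => PE i)) _.
  rewrite sumEFin sumr_const card_ord lee_fin.
  have cE : c = (d + d)%:R * n%:R ^+ 2.
    by rewrite /c -natrX -natrM; congr (_%:R); lia.
  have d0 : (d + d)%:R != 0 :> R by rewrite pnatr_eq0; lia.
  by rewrite cE -[leLHS]mulr_natl (invfM (d + d)%:R) mulrA divff// mul1r.
have mreg : measurable [set w | r < regret X g Gamma n w].
  exact: measurable_regret_gt.
have mbad : measurable [set w | (`|meanv EX n w| < m)%R \/ (v < mean EN n w)%R].
  rewrite (_ : [set _ | _] = [set w | `|meanv EX n w| < m] `|`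
    [set w | v < mean EN n w])//.
  apply: measurableU; apply: measurable_set_lt => //.
    apply: measurable_mxnorm => i.
    rewrite /meanv; under eq_fun do rewrite mxE summxE.
    by apply: measurable_funM => //; apply: measurable_sum_from1 => t t1; exact: EX_meas.
  apply: measurable_funM => //; apply: measurable_sum_from1 => t; exact: EN_meas.
have mU : measurable (\big[setU/set0]_i E i) by exact: bigsetU_measurable.
set A := [set w | (r < _)%R] in mreg *; set A' := [set w | _ \/ _] in mbad *.
have : (P (A `|` A' `|` \big[setU/set0]_i E i) <=
    P A + P A' + ((n%:R ^+ 2)^-1)%:E)%E.
  apply: le_trans (measureU2 _ _ _) _ => //; first exact: measurableU.
  by apply: leeD PU; exact: measureU2.
move=> PAU; apply: le_trans PAU.
apply: le_measure; rewrite ?inE.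
- apply: measurable_set_lt => //; apply: measurableT_comp => //.
  exact: measurable_wealth_process.
- by apply: measurableU => //; exact: measurableU.
move=> w /= Wu.
have [rw|rw] := ltP r (regret X g Gamma n w); first by left; left.
have [mw|mw] := ltP `|meanv EX n w| m; first by left; right; left.
have [vw|vw] := ltP v (mean EN n w); first by left; right; right.
right; have [i hi] := dotv_signed_basis_attained (meanv EX n w) d_ge1.
rewrite -bigcup_seq; exists i => /=; first exact: mem_index_enum.
have lnL : ln (const_wealth X (gam i) n w) =
    \sum_(1 <= t < n.+1) ln (1 + dotv (gam i) (X t w)).
  apply: ln_prod_from1 => t _.
  by have := dot_half t w (Geps i); rewrite ler_norml => /andP[]; rewrite -/(gam i); lra.
have := ln_const_wealth_le_regret g dot_half n w (Geps i).
rewrite -/(gam i) lnL => hreg.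
rewrite /E /=.
have -> : \sum_(1 <= t < n.+1) (dotv (gam i) (EX t w) - 4 * (eps ^+ 2 * EN t w)) =
    n%:R * eps * `|meanv EX n w| - 4 * n%:R * eps ^+ 2 * mean EN n w.
  rewrite -hi /meanv /mean dotvZr dotv_sumr sumrB -!big_distrr/=.
  under eq_bigr do rewrite dotvZl.
  rewrite -big_distrr/=; move: (\sum_(_ <= _ < _) _) => s1.
  by move: (\sum_(_ <= _ < _) _) => s2; field; exact: lt0r_neq0.
have h1 : n%:R * eps * m <= n%:R * eps * `|meanv EX n w|.
  by rewrite ler_wpM2l// mulr_ge0.
have h2 : 4 * n%:R * eps ^+ 2 * mean EN n w <= 4 * n%:R * eps ^+ 2 * v.
  by rewrite ler_wpM2l// !mulr_ge0// ?sqr_ge0.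
by move: hu; rewrite -/c; lra.
Qed.

(** A vanishing bet size is allowed: the third growth sequence takes it when
    m n = 0 < v n or B = 0. *)
Lemma wealth_growth (r m v u eps : nat -> R) (rho varrho : \bar R) :
  (forall n, (1 <= n)%N -> 0 <= eps n /\ forall i, Gamma (eps n *: signed_basis R i)) ->
  (forall n, (1 <= n)%N -> 0 <= m n) ->
  (forall n, (1 <= n)%N -> u n <= n%:R * eps n * m n - 4 * n%:R * eps n ^+ 2 * v n
     - r n - 2 * ln ((2 * d * n ^ 2)%N%:R)) ->
  rho = (\sum_(1 <= n <oo) P [set w | (r n < regret X g Gamma n w)%R])%E ->
  (rho < +oo)%E ->
  varrho = (\sum_(1 <= n <oo)
    P [set w | (`|meanv EX n w| < m n)%R \/ (v n < mean EN n w)%R])%E ->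
  (varrho < +oo)%E ->
  growth_conclusions P (wealth X g) u (rho + varrho + (pi ^+ 2 / 6)%:E)%E.
Proof.
move=> heps m0 hu rhoE rho_fin varrhoE varrho_fin.
apply: growth_conclusions_of_tail.
- exact: wealth_process_gt0.
- exact: measurable_wealth_process.
- have basel : (\sum_(1 <= n <oo) ((n%:R ^+ 2)^-1)%:E <= (pi ^+ 2 / 6)%:E :> \bar R)%E.
    apply: lime_le; first by apply: is_cvg_nneseries => n _ _; rewrite lee_fin.
    apply: nearW => -[|n]; rewrite sumEFin lee_fin; last exact: sum_inv_squares_le.
    by rewrite big_geq// divr_ge0// sqr_ge0.
  rewrite rhoE varrhoE.
  apply: le_trans (leeD2l _ basel).
  rewrite -!nneseriesD//; last by move=> n _ _; rewrite adde_ge0.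
  rewrite eseries_cond [leRHS]eseries_cond.
  apply: lee_nneseries => // n /= n1.
  have [eps0 Geps] := heps n n1.
  exact: (wealth_tail n1 eps0 Geps (m0 n n1) (hu n n1)).
- by rewrite !lte_add_pinfty ?ltry.
Qed.
End WealthTail.

(** The maximiser of eps m - 4 eps^2 v on [0, 1 / (2 B)] is the lesser of 1 / (2 B)
    and m / (8 v); there 4 eps v <= m / 2, so at least half of eps m is kept. *)
Lemma half_min_rate_gain (R : realType) (B m v : R) : 0 <= B -> 0 <= m -> 0 <= v ->
  let eps := min_rate B m v / 2 in
  0 <= eps <= (2 * B)^-1 /\
  m / 4 * min_rate B m v <= eps * m - 4 * eps ^+ 2 * v.
Proof.
move=> B0 m0 v0; set k := min_rate B m v.
have k0 : 0 <= k.
  rewrite /k /min_rate; case: eqP => _; first by rewrite invr_ge0.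
  by rewrite le_min invr_ge0 B0 divr_ge0// mulr_ge0.
have kB : k <= B^-1.
  by rewrite /k /min_rate; case: eqP => // _; rewrite ge_min lexx.
have kv : k * v <= m / 4.
  rewrite /k /min_rate; have [->|v_neq0] := eqVneq v 0.
    by rewrite mulr0 divr_ge0.
  have v_gt0 : 0 < v by rewrite lt_neqAle eq_sym v_neq0.
  apply: (@le_trans _ _ (m / (4 * v) * v)).
    by rewrite ler_wpM2r// ge_min lexx orbT.
  by rewrite invfM mulrA mulfVK.
split; first by rewrite invfM; apply/andP; split; lra.
by nra.
Qed.

Theorem theorem2p8 (R : realType) (d : nat) (d_ge1 : (1 <= d)%N)
    (dsp : measure_display) (T : measurableType dsp) (P : probability T R)
    (F : nat -> set (set T)) (F_filtration : filtration F)
    (XX : set 'rV[R]_d) (XX_bounded : bounded_set XX)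
    (B : R) (B_def : B = sup [set norm2 x | x in XX])
    (X : nat -> T -> 'rV[R]_d) (X_adapted : adapted F X)
    (X_valued : forall t w, XX (X t w))
    (EX : nat -> T -> 'rV[R]_d)
    (EX_cond : forall t, (1 <= t)%N -> is_cond_expv P (F t.-1) (X t) (EX t))
    (EN : nat -> T -> R)
    (EN_cond : forall t, (1 <= t)%N ->
       is_cond_exp P (F t.-1) (fun w => `|X t w| ^+ 2) (EN t))
    (Gamma : set 'rV[R]_d)
    (Gamma_bounded : forall x, Gamma x -> norm2 x <= (2 * B)^-1)
    (g : nat -> T -> 'rV[R]_d) (g_predictable : predictable F g)
    (g_valued : forall n w, (1 <= n)%N -> Gamma (g n w))
    (r m v : nat -> R)
    (r_ge0 : forall n, (1 <= n)%N -> 0 <= r n)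
    (m_ge0 : forall n, (1 <= n)%N -> 0 <= m n)
    (v_ge0 : forall n, (1 <= n)%N -> 0 <= v n)
    (rho : \bar R)
    (rho_def : rho =
       (\sum_(1 <= n <oo) P [set w | (r n < regret X g Gamma n w)%R])%E)
    (rho_fin : (rho < +oo)%E)
    (varrho : \bar R)
    (varrho_def : varrho =
       (\sum_(1 <= n <oo)
          P [set w | (`|meanv EX n w| < m n)%R \/ (v n < mean EN n w)%R])%E)
    (varrho_fin : (varrho < +oo)%E) :
  let conclusions (u : nat -> R) :=
    growth_conclusions P (wealth X g) u
      (rho + varrho + (pi ^+ 2 / 6)%:E)%E in
  let logterm (n : nat) : R := 2 * ln ((2 * d * n ^ 2)%N%:R) in
  [/\ (forall eps : nat -> R, (forall n, (1 <= n)%N -> in_E Gamma (eps n)) ->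
        conclusions (fun n => n%:R * eps n * m n - 4 * n%:R * eps n ^+ 2 * v n
                              - r n - logterm n)),
      (forall eps : R, 0 < eps <= (2 * B)^-1 ->
        (forall i : 'I_(d + d), Gamma (eps *: signed_basis R i)) ->
        conclusions (fun n => eps * n%:R * m n - 4 * eps ^+ 2 * n%:R * v n
                              - logterm n - r n)) &
      ((forall (eps : R) (i : 'I_(d + d)), 0 <= eps <= (2 * B)^-1 ->
          Gamma (eps *: signed_basis R i)) ->
        conclusions (fun n => n%:R * m n / 4 * min_rate B (m n) (v n)
                              - logterm n - r n))].
Proof.
move=> conclusions logterm.
have core u eps :
    (forall n, (1 <= n)%N ->
      0 <= eps n /\ forall i, Gamma (eps n *: signed_basis R i)) ->
    (forall n, (1 <= n)%N -> u n <= n%:R * eps n * m n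
      - 4 * n%:R * eps n ^+ 2 * v n - r n - logterm n) ->
    conclusions u.
  by move=> heps hu; exact: (@wealth_growth R d dsp T P F XX Gamma B X EX g EN
    d_ge1 F_filtration XX_bounded B_def X_adapted X_valued EX_cond EN_cond
    Gamma_bounded g_predictable g_valued r m v u eps).
split.
- move=> eps heps; apply: (core _ eps) => // n n1.
  by have [/ltW e0 he] := heps n n1.
- move=> eps /andP[/ltW e0 _] he; apply: (core _ (fun=> eps)) => // n n1.
  lra.
- move=> he.
  have B0 : 0 <= B.
    apply: le_trans (norm2_process_le XX_bounded B_def X_valued 0 point).
    exact: sqrtr_ge0.
  pose eps n := min_rate B (m n) (v n) / 2.
  apply: (core _ eps) => n n1; have [eB hm] := half_min_rate_gain B0 (m_ge0 n n1) (v_ge0 n n1).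
    by split=> [|i]; [case/andP: eB|exact: he].
  have : n%:R * (m n / 4 * min_rate B (m n) (v n)) <=
      n%:R * (eps n * m n - 4 * eps n ^+ 2 * v n) by rewrite ler_wpM2l.
  lra.
Qed.
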